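(* (Inverse) Let $a\ge 0$ and $0<\alpha<1$. Also, let $f$ be a continuous function such that ${}_{M}\mathcal{I}_{a}^{\alpha,\beta}f$ exists. Then $${}_{i}\mathscr{D}_{M}^{\alpha,\beta}\left({}_{M}\mathcal{I}_{a}^{\alpha,\beta}f(t)\right)=f(t),$$ with $t\ge a$ and $\beta>0$.
   Context: The truncated Mittag-Leffler function of one parameter is defined by ${}_{i}\mathbb{E}_{\beta}(z)=\sum_{k=0}^{i}\frac{z^{k}}{\Gamma(\beta k+1)}$, with $\beta>0$ and $z\in\mathbb{C}$, where $\Gamma$ is the Gamma function and $i$ is the upper limit of the sum. Let $f:[0,\infty)\to\mathbb{R}$. For $0<\alpha<1$ and $\beta>0$, the truncated $M$-fractional derivative type of $f$ of order $\alpha$, denoted by ${}_{i}\mathscr{D}_{M}^{\alpha,\beta}$, is $${}_{i}\mathscr{D}_{M}^{\alpha,\beta}f(t):=\lim_{\varepsilon\to 0}\frac{f\left(t\,{}_{i}\mathbb{E}_{\beta}(\varepsilon t^{-\alpha})\right)-f(t)}{\varepsilon},\qquad \forall t>0.$$ If this derivative of order $\alpha$ exists, $f$ is said to be $\alpha$-differentiable. If $f$ is $\alpha$-differentiable in some open interval $(0,\delta)$, $\delta>0$, and $\lim_{t\to 0^{+}}{}_{i}\mathscr{D}_{M}^{\alpha,\beta}f(t)$ exists, then ${}_{i}\mathscr{D}_{M}^{\alpha,\beta}f(0)=\lim_{t\to 0^{+}}{}_{i}\mathscr{D}_{M}^{\alpha,\beta}f(t)$. Let $a\ge 0$ and $t\ge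 a$, let $f$ be a function defined in $(a,t]$, and let $0<\alpha<1$. The $M$-fractional integral of order $\alpha$ of the function $f$ is defined by $${}_{M}\mathcal{I}_{a}^{\alpha,\beta}f(t)=\Gamma(\beta+1)\int_{a}^{t}\frac{f(x)}{x^{1-\alpha}}\,dx,$$ with $\beta>0$.
   Formalization: The upper limit i of the truncated Mittag-Leffler sum is assumed to be at least 1; for i = 0 the function is constantly 1, the derivative is identically 0, and the claim fails, e.g. for f = 1. *)

(* Defs.v *)
From HB Require Import structures.
From mathcomp Require Import all_boot all_order all_algebra.
From mathcomp Require Import all_classical all_reals all_analysis.

Set Implicit Arguments.
Unset Strict Implicit.
Unset Printing Implicit Defensive.

Import Order.TTheory GRing.Theory Num.Theory.
Import numFieldNormedType.Exports.

Local Open Scope classical_set_scope.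
Local Open Scope ring_scope.

(* Euler's integral of the second kind; meaningful for 0 < x. *)
Definition Gamma (R : realType) (x : R) : R :=
  \int[lebesgue_measure]_(s in `]0, +oo[) (s `^ (x - 1) * expR (- s)).

(* Only real arguments z occur in the fractional derivative below. *)
Definition truncML (R : realType) (i : nat) (beta z : R) : R :=
  \sum_(k < i.+1) z ^+ k / Gamma (beta * k%:R + 1).

Section TruncatedMDerivative.
Variables (R : realType) (i : nat) (alpha beta : R).

(* D is the domain of the function f, a subset of [0, +oo[; values of the total
   function f outside D are never used.  As usual, the limit of the difference
   quotient is taken over the eps <> 0 at which the quotient is defined.  When t
   is interior to D (so for every t > 0 if D = [0, +oo[), this is the two-sided
   limit eps -> 0; at a left endpoint t > 0 of D it is the one-sided limit. *)

Definition Mquotient (f : R -> R) (t eps : R) : R :=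
  (f (t * truncML i beta (eps * t `^ (- alpha))) - f t) / eps.

Definition Mfilter (D : set R) (t : R) : set_system R :=
  within [set eps | D (t * truncML i beta (eps * t `^ (- alpha)))] 0^'.

Definition Mdifferentiable_pos (D : set R) (f : R -> R) (t : R) : Prop :=
  cvg (Mquotient f t eps @[eps --> Mfilter D t]).

Definition Mderiv_pos (D : set R) (f : R -> R) (t : R) : R :=
  lim (Mquotient f t eps @[eps --> Mfilter D t]).

(* For t >= 0 in D; at t = 0, where t^(-alpha) is not available, existence and
   value are those of the limit of the derivative from the right. *)
Definition Mdifferentiable (D : set R) (f : R -> R) (t : R) : Prop :=
  if t == 0 then
    (exists2 delta : R, 0 < delta &
       forall s, 0 < s < delta -> D s /\ Mdifferentiable_pos D f s) /\
    cvg (Mderiv_pos D f s @[s --> 0^'+])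
  else Mdifferentiable_pos D f t.

Definition Mderiv (D : set R) (f : R -> R) (t : R) : R :=
  if t == 0 then lim (Mderiv_pos D f s @[s --> 0^'+]) else Mderiv_pos D f t.

End TruncatedMDerivative.

(* For 0 <= a <= t.  When a = 0 and alpha < 1 the integrand may be singular at
   the excluded endpoint 0. *)
Definition Mintegrable (R : realType) (alpha a : R) (f : R -> R) (t : R) :
    Prop :=
  (@lebesgue_measure R).-integrable `]a, t]
    (fun x => (f x / x `^ (1 - alpha))%:E).

Definition Mintegral (R : realType) (alpha beta a : R) (f : R -> R) (t : R) :
    R :=
  Gamma (beta + 1) *
  \int[lebesgue_measure]_(x in `]a, t]) (f x / x `^ (1 - alpha)).

(* Main.v *)
Require Import Defs.
From HB Require Import structures.
From mathcomp Require Import all_boot all_order all_algebra.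
From mathcomp Require Import all_classical all_reals all_analysis.
From mathcomp Require Import measurable_realfun.
From mathcomp Require Import ring lra.

Set Implicit Arguments.
Unset Strict Implicit.
Unset Printing Implicit Defensive.

Import Order.TTheory GRing.Theory Num.Theory.
Import numFieldNormedType.Exports.

Local Open Scope classical_set_scope.
Local Open Scope ring_scope.

(** At a point t > 0 the argument of the M-derivative is
      t * E(eps * t^-alpha) = t + eps * m(eps),
    where m(eps) tends to t^(1-alpha) / Gamma(beta+1): only the first two terms
    of the truncated Mittag-Leffler sum matter, since Gamma(1) = 1 makes the
    constant term 1 ([truncML_slope], [Mpoint_slope]).  The integral
    F(y) = Gamma(beta+1) * int_a^y f(x) / x^(1-alpha) dx satisfies
      F(y) - F(t) = Gamma(beta+1) * phi(y) * (y - t)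
    with phi(y) tending to f(t) / t^(1-alpha) as y tends to t within [a, +oo[.
    This is the fundamental theorem of calculus in Caratheodory form
    ([Rintegral_slope]); it covers the one-sided case t = a.  The difference
    quotient is therefore exactly
      Gamma(beta+1) * phi(t + eps * m(eps)) * m(eps),
    and in the limit both factors Gamma(beta+1) and t^(1-alpha) cancel, leaving
    f(t) ([Mquotient_cvg]).

    The cancellation needs Gamma(beta+1) <> 0.  As Gamma is a real-valued
    integral, equal to 0 when the integral diverges, this requires both the
    convergence of Euler's integral ([integrable_Gamma]) and its positivity
    ([Gamma_gt0]).  Positivity also makes m(eps) > 0 for small eps, so that for
    small eps > 0 the point t + eps * m(eps) stays in [a, +oo[ even if t = a:
    the filter along which the limit is taken is proper, and the limit is
    unique ([Mfilter_proper]).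

    If t = 0, then a = 0, the M-derivative of F at every s > 0 is f(s), and the
    limit of f(s) as s tends to 0 from the right is f(0) by continuity. *)

Lemma integrable_expRN (R : realType) (c : R) : 0 < c ->
  (@lebesgue_measure R).-integrable `]0, +oo[ (fun s => (expR (- (c * s)))%:E).
Proof.
move=> c0.
have ie : (@lebesgue_measure R).-integrable `]0, +oo[
    (EFin \o exponential_pdf c).
  by apply: integrableS (integrable_exponential_pdf c0).
have := integrableZl _ c^-1 ie.
move=> /(_ (measurable_itv _)); apply: eq_integrable => //= s.
rewrite inE/= in_itv/= andbT => s0.
rewrite exponential_pdfE ?ltW// -EFinM mulrA mulVf ?gt_eqF// mul1r.
by rewrite mulNr.
Qed.

Lemma Gamma1 (R : realType) : Gamma (1 : R) = 1.
Proof.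
transitivity (\int[@lebesgue_measure R]_s exponential_pdf 1 s); last first.
  by rewrite /Rintegral integral_exponential_pdf.
have -> : exponential_pdf 1 = (fun s : R => expR (- s)) \_ `[0, +oo[.
  by congr patch; apply/funext => s; rewrite mul1r mulN1r.
rewrite -Rintegral_mkcond -Rintegral_itv_obnd_cbnd; last first.
  have := integrable_expRN (@ltr01 R).
  by apply: eq_integrable => // s _; rewrite mul1r.
by apply: eq_Rintegral => s _; rewrite subrr powRr0 mul1r.
Qed.

(** From ln u < u at u = s / (2 b): any power of s is dominated by half of the
    exponential, which leaves exp (- s / 2) to make Euler's integral converge. *)
Lemma powR_le_expR (R : realType) (b s : R) : 0 < b -> 0 < s ->
  s `^ b <= expR (b * ln (2 * b)) * expR (2^-1 * s).
Proof.
move=> b0 s0; have b20 : 0 < 2 * b by lra.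
rewrite -expRD /powR gt_eqF// ler_expR.
have := ln_sublinear (divr_gt0 s0 b20).
rewrite ln_div ?posrE// => /ltW.
rewrite lerBlDr -(ler_pM2l b0) => /le_trans; apply.
rewrite mulrDr addrC lerD2l le_eqVlt; apply/orP; left; apply/eqP; field.
by rewrite gt_eqF.
Qed.

Lemma integrable_Gamma (R : realType) (b : R) : 0 < b ->
  (@lebesgue_measure R).-integrable `]0, +oo[
    (fun s => (s `^ (b + 1 - 1) * expR (- s))%:E).
Proof.
move=> b0; rewrite addrK.
have h0 : 0 < 2^-1 :> R by lra.
have := integrableZl _ (expR (b * ln (2 * b)))
  (integrable_expRN h0).
move=> /(_ (measurable_itv _)); apply: le_integrable => //.
  apply/measurable_EFinP; apply: measurable_funM.
    by apply: measurable_funTS; exact: measurable_powR.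
  apply: measurable_funTS; apply: measurableT_comp => //.
move=> s /=; rewrite in_itv/= andbT => s0.
rewrite lee_fin !ger0_norm ?mulr_ge0 ?powR_ge0 ?expR_ge0//.
apply: le_trans (ler_wpM2r (expR_ge0 _) (powR_le_expR b0 s0)) _.
rewrite -mulrA -expRD; apply: ler_wpM2l; first exact: expR_ge0.
by rewrite ler_expR; lra.
Qed.

(** The integrand is at least exp (- 2) on ]1, 2], an interval of length 1. *)
Lemma Gamma_gt0 (R : realType) (b : R) : 0 < b -> 0 < Gamma (b + 1).
Proof.
move=> b0; have ig := integrable_Gamma b0.
have sub12 : (`]1, 2] : set R) `<=` `]0, +oo[.
  by move=> s /=; rewrite !in_itv/= andbT => /andP[s1 _]; lra.
have ig12 : (@lebesgue_measure R).-integrable `]1, 2]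
    (fun s => (s `^ (b + 1 - 1) * expR (- s))%:E) by exact: integrableS ig.
have -> : 0 = \int[@lebesgue_measure R]_(s in `]1, 2]) 0.
  by rewrite Rintegral_cst// mul0r.
apply: (@lt_le_trans _ _ (\int[lebesgue_measure]_(s in `]1%R, 2%R]) expR (- 2))).
  rewrite !Rintegral_cst//= mul0r lebesgue_measure_itv/= lte_fin ltr1n/=.
  by rewrite mulr_gt0 ?expR_gt0//; lra.
apply: (@le_trans _ _ (\int[lebesgue_measure]_(s in `]1%R, 2%R])
   (s `^ (b + 1 - 1) * expR (- s)))).
  apply: le_Rintegral => //.
    apply: measurable_bounded_integrable => //.
      by rewrite /= lebesgue_measure_itv/=; case: ifP => _; rewrite -?EFinD ltry.
    exists `|expR (- 2) : R|; split; rewrite ?num_real// => M rM z _; exact: ltW.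
  move=> s /=; rewrite in_itv/= => /andP[/ltW s1 s2].
  rewrite -[leLHS]mul1r ler_pM ?expR_ge0// ?ler_expR ?lerN2//.
  by rewrite -[leLHS](@powRr0 _ s) ler_powR// addrK ltW.
rewrite /Gamma /Rintegral fine_le ?integrable_fin_num//.
apply: ge0_subset_integral => //; first exact: measurable_int ig.
by move=> s _; rewrite lee_fin mulr_ge0 ?powR_ge0 ?expR_ge0.
Qed.

(** The order-one Taylor form at 0.  Dividing the sum minus its constant term
    by z gives a polynomial, so its limit at 0 is its value there, whatever the
    higher coefficients are. *)
Lemma truncML_slope (R : realType) (i : nat) (beta : R) : (1 <= i)%N ->
  exists p : {poly R}, p.[0] = (Gamma (beta + 1))^-1 /\
    forall z, truncML i beta z = 1 + z * p.[z].
Proof.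
case: i => // i _.
exists (\poly_(k < i.+1) (Gamma (beta * k.+1%:R + 1))^-1); split.
  by rewrite horner_coef0 coef_poly mulr1.
move=> z; rewrite /truncML big_ord_recl expr0 mulr0 add0r Gamma1 divr1.
congr (_ + _); rewrite horner_poly mulr_sumr; apply: eq_bigr => k _.
by rewrite exprS; ring.
Qed.

(** Here c is any constant rather than the value of g at x, so that the same
    estimate serves a derivative from the right (c = g x) and from the left
    (c = g y). *)
Lemma Rintegral_itv_linear_error (R : realType) (g : R -> R) (a x y c e : R) :
  a <= x -> x <= y ->
  (@lebesgue_measure R).-integrable `]a, y] (EFin \o g) ->
  (forall z, x < z <= y -> `|g z - c| <= e) ->
  `|\int[lebesgue_measure]_(z in `]a, y]) g z -
    \int[lebesgue_measure]_(z in `]a, x]) g z - c * (y - x)| <= e * (y - x).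
Proof.
move=> ax xy ig gc.
rewrite Rintegral_itvB ?bnd_simp//.
have cst_itv (r : R) :
    r * (y - x) = \int[@lebesgue_measure R]_(z in `]x, y]) r.
  rewrite Rintegral_cst//= lebesgue_measure_itv/= lte_fin.
  by move: xy; rewrite le_eqVlt => /predU1P[->|->//]; rewrite ltxx subrr.
have icst (r : R) : (@lebesgue_measure R).-integrable `]x, y] (EFin \o cst r).
  apply: measurable_bounded_integrable => //.
    by rewrite /= lebesgue_measure_itv/=; case: ifP => _; rewrite -?EFinD ltry.
  by exists `|r|; split; rewrite ?num_real// => M rM z _; exact: ltW.
have igxy : (@lebesgue_measure R).-integrable `]x, y] (EFin \o g).
  by apply: integrableS ig => //; apply: subset_itvr; rewrite bnd_simp.
have igc : (@lebesgue_measure R).-integrable `]x, y]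
    (EFin \o (fun z => g z - c)).
  by have := integrableB _ igxy (icst c); apply.
rewrite !cst_itv -RintegralB//; last exact: icst.
apply: le_trans (le_normr_Rintegral _ igc) _ => //.
apply: le_Rintegral => //; first exact: integrable_norm igc.
exact: icst.
Qed.

(** Writing the difference as an exact product, with phi the slope of the
    integral completed by g t at t, lets y be replaced later by a function of
    eps that may take the value t. *)
Lemma Rintegral_slope (R : realType) (g : R -> R) (a t : R) : a <= t ->
  (forall y, a <= y -> (@lebesgue_measure R).-integrable `]a, y] (EFin \o g)) ->
  g x @[x --> within `[a, +oo[ (nbhs t)] --> g t ->
  exists2 phi : R -> R,
    forall y, \int[lebesgue_measure]_(x in `]a, y]) g x -
      \int[lebesgue_measure]_(x in `]a, t]) g x = phi y * (y - t) &
    phi y @[y --> within `[a, +oo[ (nbhs t)] --> g t.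
Proof.
move=> at_ ig gt; pose G y := \int[lebesgue_measure]_(x in `]a, y]) g x.
exists (fun y => if y == t then g t else (G y - G t) / (y - t)).
  move=> y; have [->|yt] := eqVneq y t; first by rewrite !subrr mulr0.
  by rewrite divfK// subr_eq0.
apply/cvgrPdist_le => e e0.
have [d/= d0 gd] : exists2 d, 0 < d &
    forall z, `|t - z| < d -> a <= z -> `|g z - g t| <= e.
  move/cvgrPdist_le : gt => /(_ e e0) [d/= d0 gd]; exists d => // z zd az.
  by rewrite distrC; apply: gd => //=; rewrite in_itv/= az.
exists d => // y /= yd; rewrite in_itv/= andbT => ay.
case: eqVneq => [_|yt]; first by rewrite subrr normr0 ltW.
have yt0 : y - t != 0 by rewrite subr_eq0.
rewrite distrC -(ler_pM2r (_ : 0 < `|y - t|)) ?normr_gt0//.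
rewrite -normrM mulrBl divfK//.
have [ty|] := leP t y.
  rewrite (ger0_norm (_ : 0 <= y - t)) ?subr_ge0//.
  apply: Rintegral_itv_linear_error => //; first exact: ig.
  move=> z /andP[tz zy]; apply: gd; last by lra.
  apply: le_lt_trans yd; rewrite distrC [leRHS]distrC !ger0_norm; lra.
(* For y < t the same estimate applies with the roles of y and t exchanged. *)
move/ltW => yt'.
rewrite distrC (distrC y) (ger0_norm (_ : 0 <= t - y)) ?subr_ge0//.
rewrite [X in `|X|](_ : _ = G t - G y - g t * (t - y)); last by ring.
apply: Rintegral_itv_linear_error => //; first exact: ig.
move=> z /andP[yz zt]; apply: gd; last by lra.
by apply: le_lt_trans yd; rewrite !ger0_norm; lra.
Qed.

(** The slope form of the point at which the M-derivative evaluates its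
    function; the limit of m is the factor relating the M-derivative to the
    ordinary derivative. *)
Lemma Mpoint_slope (R : realType) (i : nat) (alpha beta t : R) :
  (1 <= i)%N -> 0 < t ->
  exists2 m : R -> R,
    forall eps, t * truncML i beta (eps * t `^ (- alpha)) = t + eps * m eps &
    m eps @[eps --> (0 : R)] --> t `^ (1 - alpha) / Gamma (beta + 1).
Proof.
move=> i1 t0; have [p [p0 pE]] := truncML_slope beta i1.
exists (fun eps => t * t `^ (- alpha) * p.[eps * t `^ (- alpha)]).
  by move=> eps; rewrite pE; ring.
have -> : t `^ (1 - alpha) = t * t `^ (- alpha).
  rewrite powRD; last by rewrite (gt_eqF t0) implybT.
  by rewrite powRr1 // ltW.
apply: cvgM; first exact: cvg_cst.
rewrite -p0; apply: continuous_cvg; first exact: continuous_horner.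
rewrite -[X in _ --> X](mul0r (t `^ (- alpha))).
by apply: cvgM; [exact: cvg_id | exact: cvg_cst].
Qed.

(** For small eps > 0 the slope m eps is positive, so the evaluation point lies
    to the right of t and hence in the domain.  This is what makes the limit at
    the endpoint t = a meaningful. *)
Lemma Mfilter_proper (R : realType) (i : nat) (alpha beta a t : R) :
  (1 <= i)%N -> 0 < beta -> a <= t -> 0 < t ->
  ProperFilter (Mfilter i alpha beta `[a, +oo[ t).
Proof.
move=> i1 beta0 at_ t0.
have [m mE m0] := Mpoint_slope alpha beta i1 t0.
apply: Build_ProperFilter_ex => A; rewrite /Mfilter /within/= => nA.
have mgt0 : \forall eps \near (0:R)^'+, 0 < m eps.
  have m1 : m eps @[eps --> (0:R)^'+] --> t `^ (1 - alpha) / Gamma (beta + 1).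
    by apply: cvg_at_right_filter.
  by apply: (cvgr_gt _ m1); rewrite divr_gt0 ?powR_gt0// Gamma_gt0.
have nA' : \forall eps \near (0:R)^'+,
    `[a, +oo[%classic (t * truncML i beta (eps * t `^ (- alpha))) -> A eps.
  have : \forall e \near nbhs (0:R), e != 0 ->
      `[a, +oo[%classic (t * truncML i beta (e * t `^ (- alpha))) -> A e.
    exact: nA.
  move=> nA0; rewrite /at_right near_withinE.
  by apply: filterS nA0 => e Ae /gt_eqF e0; apply: Ae; rewrite e0.
have [eps [[e0 me] /(_ _)]] : exists eps, (0 < eps /\ 0 < m eps) /\
   (`[a, +oo[%classic (t * truncML i beta (eps * t `^ (- alpha))) -> A eps).
  apply: (@filter_ex _ ((0:R)^'+)); near=> e; split; last by near: e.
  by split; near: e => //; exact: nbhs_right_gt.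
move=> Ae; exists eps; apply: Ae; rewrite mE/= in_itv/= andbT.
by rewrite (le_trans at_)// lerDl mulr_ge0// ltW.
Unshelve. all: by end_near. Qed.

Lemma cvg_within_div_powR (R : realType) (alpha a t : R) (f : R -> R) : 0 < t ->
  f x @[x --> within `[a, +oo[ (nbhs t)] --> f t ->
  f x / x `^ (1 - alpha) @[x --> within `[a, +oo[ (nbhs t)] -->
    f t / t `^ (1 - alpha).
Proof.
move=> t0 ft; apply: cvgM => //; apply: cvgV; first by rewrite gt_eqF// powR_gt0.
apply: cvg_within_filter.
have : derivable (@powR R ^~ (1 - alpha)) t 1.
  by apply: derivable_powR; rewrite in_itv/= t0.
by move/derivable1_diffP/differentiable_continuous.
Qed.

Lemma Mquotient_cvg (R : realType) (i : nat) (alpha beta a t : R) (f : R -> R) :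
  (1 <= i)%N -> 0 < beta -> a <= t -> 0 < t ->
  f x @[x --> within `[a, +oo[ (nbhs t)] --> f t ->
  (forall y : R, a <= y -> Mintegrable alpha a f y) ->
  Mquotient i alpha beta (Mintegral alpha beta a f) t eps
    @[eps --> Mfilter i alpha beta `[a, +oo[ t] --> f t.
Proof.
move=> i1 beta0 at_ t0 ft fi.
have PF := Mfilter_proper alpha i1 beta0 at_ t0.
have [m mE m0] := Mpoint_slope alpha beta i1 t0.
have [phi phiE phit] := Rintegral_slope at_ fi (cvg_within_div_powR t0 ft).
have m0' : m eps @[eps --> Mfilter i alpha beta `[a, +oo[ t] -->
    t `^ (1 - alpha) / Gamma (beta + 1).
  apply: cvg_within_filter; apply: cvg_trans m0.
  exact/cvg_app/nbhs_dnbhs.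
have hcvg : t + eps * m eps @[eps --> Mfilter i alpha beta `[a, +oo[ t] -->
    within `[a, +oo[ (nbhs t).
  have h0 : t + eps * m eps @[eps --> (0:R)] --> t.
    have -> : nbhs t = nbhs (t + 0 * (t `^ (1 - alpha) / Gamma (beta + 1))).
      by rewrite mul0r addr0.
    by apply: cvgD; [exact: cvg_cst | apply: cvgM => //; exact: cvg_id].
  move=> A /h0 /nbhs_dnbhs /= hA; rewrite /Mfilter/within/=.
  by apply: filterS hA => e he De; apply: he; rewrite -mE.
have G0 := Gamma_gt0 beta0.
have -> : f t = Gamma (beta + 1) * (f t / t `^ (1 - alpha)) *
                (t `^ (1 - alpha) / Gamma (beta + 1)).
  by field; rewrite !gt_eqF ?powR_gt0.
apply: (@cvg_trans _ (Gamma (beta + 1) * phi (t + eps * m eps) * m eps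
    @[eps --> Mfilter i alpha beta `[a, +oo[ t])); last first.
  apply: cvgM => //; apply: cvgM; first exact: cvg_cst.
  exact: cvg_comp hcvg phit.
have eps0 : \forall e \near Mfilter i alpha beta `[a, +oo[ t, e != 0.
  by apply: cvg_within; exact: (@withinT _ (nbhs (0:R))).
apply: near_eq_cvg; apply: filterS eps0 => e e0.
by rewrite /Mquotient /Mintegral -mulrBr mE phiE; field.
Qed.

Theorem theorem6 (R : realType) (i : nat) (alpha beta a : R) (f : R -> R)
    (hi : (1 <= i)%N) (ha : 0 <= a) (halpha : 0 < alpha < 1) (hbeta : 0 < beta)
    (hf : {within `[a, +oo[, continuous f})
    (hint : forall t : R, a <= t -> Mintegrable alpha a f t) :
  forall t : R, a <= t ->
    Mdifferentiable i alpha beta `[a, +oo[ (Mintegral alpha beta a f) t /\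
    Mderiv i alpha beta `[a, +oo[ (Mintegral alpha beta a f) t = f t.
Proof.
have pos t : a <= t -> 0 < t ->
    Mdifferentiable_pos i alpha beta `[a, +oo[ (Mintegral alpha beta a f) t /\
    Mderiv_pos i alpha beta `[a, +oo[ (Mintegral alpha beta a f) t = f t.
  move=> at_ t0; have PF := Mfilter_proper alpha hi hbeta at_ t0.
  have ft : f x @[x --> within `[a, +oo[ (nbhs t)] --> f t.
    by move/subspace_continuousP : hf; apply; rewrite /= in_itv/= at_.
  have lim_t := Mquotient_cvg hi hbeta at_ t0 ft hint.
  by split; [apply/cvg_ex; exists (f t) | exact: cvg_lim lim_t].
move=> t at_; rewrite /Mdifferentiable /Mderiv.
have [t0|t0] := eqVneq t 0; last first.
  by apply: pos => //; rewrite lt_neqAle eq_sym t0 (le_trans ha).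
have a0 : a = 0 by apply/eqP; rewrite eq_le ha -t0 at_.
have lim0 : Mderiv_pos i alpha beta `[a, +oo[ (Mintegral alpha beta a f) s
    @[s --> 0^'+] --> f t.
  apply: (@cvg_trans _ (f s @[s --> 0^'+])); last first.
    by move/continuous_within_itvcyP : hf => [_]; rewrite a0 t0.
  apply: near_eq_cvg; near=> s.
  have s0 : 0 < s by near: s; exact: nbhs_right_gt.
  by apply/esym/(pos s _ s0).2; rewrite a0 ltW.
split; last exact: cvg_lim lim0.
split; last by apply/cvg_ex; exists (f t).
exists 1 => // s /andP[s0 _]; rewrite {1}a0 /= in_itv/= ltW//; split => //.
by apply: (pos s _ s0).1; rewrite a0 ltW.
Unshelve. all: by end_near. Qed.
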